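(* $Ps$-Tychonoffness is an additive property: if $(X_\alpha)_{\alpha\in\Lambda}$ is a family of $Ps$-Tychonoff topological spaces, then the topological sum (disjoint union) $\bigoplus_{\alpha\in\Lambda}X_\alpha$ is $Ps$-Tychonoff.
   Context: A topological space is pseudocompact if every real-valued continuous function on it is bounded; a subset is called pseudocompact if it is pseudocompact in the subspace topology. Tychonoff means completely regular and $T_1$. A space $X$ is $Ps$-Tychonoff if there exist a Tychonoff space $Y$ and a bijection $f:X\to Y$ such that $f|_K:K\to f(K)$ is a homeomorphism (subspace topologies) for every pseudocompact subset $K$ of $X$. *)

(* Defs.v *)
From HB Require Import structures.
From mathcomp Require Import all_boot all_order all_algebra.
From mathcomp Require Import all_classical all_reals all_analysis.

Set Implicit Arguments.
Unset Strict Implicit.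
Unset Printing Implicit Defensive.

Import Order.TTheory GRing.Theory Num.Theory.
Import numFieldNormedType.Exports.
Local Open Scope classical_set_scope.
Local Open Scope ring_scope.

Definition pseudocompact_space (R : realType) (X : topologicalType) : Prop :=
  forall f : X -> R, continuous f -> bounded_fun f.

(* [K] is coerced to the subtype [set_type K], whose topology is the one
   induced by [X]. *)
Definition pseudocompact (R : realType) (X : topologicalType) (K : set X) :
  Prop := pseudocompact_space R K.

Definition homeomorphism (X Y : topologicalType) (f : X -> Y) : Prop :=
  exists g : Y -> X, [/\ cancel f g, cancel g f, continuous f & continuous g].

(* [f] restricted to [K] and corestricted to [f @` K]. *)
Definition restr_image (X Y : Type) (f : X -> Y) (K : set X) : K -> f @` K :=
  sigLR [fun f in K].

Lemma restr_imageE (X Y : Type) (f : X -> Y) (K : set X) (x : K) :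
  \val (restr_image f x) = f (\val x).
Proof. by []. Qed.

(* The library defines complete regularity through uniformities; this is the
   usual formulation by real-valued functions. *)
Lemma completely_regular_spaceP (R : realType) (X : topologicalType) :
  completely_regular_space X <->
  forall (a : X) (B : set X), closed B -> ~ B a ->
    exists f : X -> R, [/\ continuous f, range f `<=` `[0, 1],
                           f a = 0 & forall b, B b -> f b = 1].
Proof.
split=> [crX a B clB nBa|crX a B clB nBa].
  have [f [cf f01 fa fB]] := (@uniform_separatorP X R _ _).1 (crX a B clB nBa).
  exists f; split=> //; first by apply: fa; exists a.
  by move=> b Bb; apply: fB; exists b.
have [f [cf f01 fa fB]] := crX a B clB nBa.
apply/(@uniform_separatorP X R); exists f; split=> //.
  by move=> _ [_ -> <-].
by move=> _ [b Bb <-]; exact: fB.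
Qed.

Definition tychonoff_space (X : topologicalType) : Prop :=
  completely_regular_space X /\ accessible_space X.

Definition ps_tychonoff (R : realType) (X : topologicalType) : Prop :=
  exists (Y : topologicalType) (f : X -> Y),
    [/\ tychonoff_space Y, bijective f &
        forall K : set X, pseudocompact R K ->
          homeomorphism (@restr_image X Y f K)].

(* Main.v *)
(** The sum [F] of the given bijections [f i : X i -> Y i] works. If [K] is
    pseudocompact in the sum of the [X i], each slice of [K] is pseudocompact,
    because a continuous function on a slice, extended by a constant to the
    other summands, is continuous on [K]. Continuity on [K] of [F], and on
    [F @` K] of its inverse, can be checked slice by slice, where it is the
    hypothesis on [f i]. The same extension by a constant shows that the sum of
    the [Y i] is completely regular. *)

Require Import Defs.
From HB Require Import structures.
From mathcomp Require Import all_boot all_order all_algebra.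
From mathcomp Require Import all_classical all_reals all_analysis.

Set Implicit Arguments.
Unset Strict Implicit.
Unset Printing Implicit Defensive.

Import Order.TTheory GRing.Theory Num.Theory.
Import numFieldNormedType.Exports.
Local Open Scope classical_set_scope.
Local Open Scope ring_scope.

Lemma homeomorphism_restr_imageP (X Y : topologicalType) (f : X -> Y)
    (g : Y -> X) (K : set X) : cancel f g -> cancel g f ->
  homeomorphism (@restr_image X Y f K) <->
  {within K, continuous f} /\ {within f @` K, continuous g}.
Proof.
move=> fK gK; split=> [[h [rK hK cr ch]]|[cf cg]].
  have ghE (y : f @` K) : g (set_val y) = set_val (h y).
    by rewrite -{1}[y]hK; exact: fK.
  split; apply/subspace_sigL_continuousP.
    have -> : sigL K f = set_val \o @restr_image X Y f K.
      by apply/funext => x.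
    by move=> x; apply: (continuous_comp (cr x)); exact: initial_continuous.
  have -> : sigL (f @` K) g = set_val \o h by apply/funext.
  by move=> y; apply: (continuous_comp (ch y)); exact: initial_continuous.
have gfK (y : f @` K) : K (g (\val y)).
  by case: y => y /= /set_mem[x Kx <-]; rewrite fK.
pose h (y : f @` K) : K := exist _ (g (\val y)) (mem_set (gfK y)).
exists h; split.
- by move=> x; apply: val_inj; rewrite /= fK.
- by move=> y; apply: val_inj; rewrite restr_imageE /= gK.
- apply: continuous_comp_initial.
  exact/subspace_sigL_continuousP.
- apply: continuous_comp_initial.
  exact/subspace_sigL_continuousP.
Qed.

Lemma pseudocompactP (R : realType) (X : topologicalType) (K : set X) :
  pseudocompact R K <->
  forall f : X -> R, {within K, continuous f} -> [bounded f x | x in K].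
Proof.
split=> [pK f /subspace_sigL_continuousP/pK|pK f].
  rewrite /= /bounded_near; apply: filterS => M bM x Kx.
  by have := bM (exist _ x (mem_set Kx)) I.
(* The function on the subtype is the restriction of its extension by 0 to [X]; the values off [K]
   are irrelevant to continuity within [K]. *)
rewrite -[f](@valLK _ _ (0 : R)) => /subspace_sigL_continuousP/pK.
rewrite /= /bounded_near; apply: filterS => M bM x _.
by apply: bM; exact/set_mem/valP.
Qed.

Section sigT.
Context {I : choiceType} {X : I -> topologicalType}.

(** The neighbourhood filter of [existT X i x] is the image under [existT X i] of that of [x], so
    continuity at a point only concerns its own summand. *)
Lemma sigT_within_continuousP {Z : topologicalType} (K : set {i & X i})
    (h : {i & X i} -> Z) :
  {within K, continuous h} <->
  forall i, {within existT X i @^-1` K, continuous (h \o existT X i)}.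
Proof.
split=> [/subspace_continuousP ch i|ch]; apply/subspace_continuousP.
  by move=> x Kx; exact: ch Kx.
by case=> i x Kx; have /subspace_continuousP := ch i; exact.
Qed.

Lemma untag_existT (T : Type) (z : T) (i : I) (f : X i -> T) (x : X i) :
  untag z f (existT X i x) = f x.
Proof. exact: (untagE z f (erefl : tag (existT X i x) = i)). Qed.

(** On summand [i] the extension is [f], and on every other summand it is the constant [z]. *)
Lemma within_continuous_untag {Z : topologicalType} (z : Z) (i : I)
    (f : X i -> Z) (K : set {i & X i}) :
  {within existT X i @^-1` K, continuous f} ->
  {within K, continuous (untag z f)}.
Proof.
move=> cf; apply/sigT_within_continuousP => j; have [<-|ij] := eqVneq i j.
  have -> // : untag z f \o existT X i = f.
  by apply/funext => x; exact: untag_existT.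
have -> : untag z f \o existT X j = cst z.
  by apply/funext => x; rewrite /= untag_dflt//= eq_sym.
by apply: continuous_subspaceT; exact: cst_continuous.
Qed.

Lemma pseudocompact_existT_preimage (R : realType) (K : set {i & X i}) (i : I) :
  pseudocompact R K -> pseudocompact R (existT X i @^-1` K).
Proof.
move=> /pseudocompactP pK; apply/pseudocompactP => f.
move=> /(within_continuous_untag (z := 0 : R))/pK.
rewrite /bounded_near; apply: filterS => M bM x Kx.
by have := bM (existT X i x) Kx; rewrite /= untag_existT.
Qed.

Lemma accessible_sigT :
  (forall i, accessible_space (X i)) -> accessible_space {i & X i}.
Proof.
move=> accX [i x] y xy.
have [yi|yi] := eqVneq (tag y) i; last first.
  (* For points in different summands, the whole summand of the first one separates. *)
  exists (existT X i @` setT); split; first exact/existT_open_map/openT.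
    by rewrite inE; exists x.
  by rewrite inE => -[x' _ yE]; rewrite -yE/= eqxx in yi.
case: y yi xy => j y /= ji; subst j => xy.
have /accX[A [oA xA yA]] : x != y by apply: contraNneq xy => ->.
exists (existT X i @` A); split; first exact: existT_open_map.
  by rewrite inE; exists x => //; exact: set_mem.
(* [untag x id] is a left inverse of [existT X i], which yields [z = y] from the equality of
   dependent pairs. *)
rewrite inE => -[z Az /(congr1 (untag x id))]; rewrite !untag_existT => zy.
by move: yA; rewrite inE -zy; exact.
Qed.

Lemma completely_regular_sigT (R : realType) :
  (forall i, completely_regular_space (X i)) ->
  completely_regular_space {i & X i}.
Proof.
move=> crX; apply/(completely_regular_spaceP R) => -[i a] B clB nBa.
have clBi : closed (existT X i @^-1` B).
  by apply: preimage_closed clB => x _; exact: existT_continuous.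
have [f [cf f01 fa fB]] :=
  (completely_regular_spaceP R _).1 (crX i) _ _ clBi nBa.
(* The default is 1 because [B] may meet the other summands, where the function must take the value
   1. *)
exists (untag 1 f); split.
- apply/continuous_subspace_setT/within_continuous_untag.
  exact: continuous_subspaceT.
- move=> _ [p _ <-]; have [pi|pi] := eqVneq (tag p) i.
    by rewrite (untagE _ _ pi); apply: f01; exists (etagged pi).
  by rewrite untag_dflt//= in_itv/= ler01 lexx.
- by rewrite untag_existT.
- move=> [j b] Bb; have [ji|ji] := eqVneq j i; last by rewrite untag_dflt.
  by subst j; rewrite untag_existT; exact: fB.
Qed.

End sigT.

Lemma sigT_map_within_continuous (I : choiceType) (X Y : I -> topologicalType)
    (f : forall i, X i -> Y i) (K : set {i & X i}) :
  (forall i, {within existT X i @^-1` K, continuous (f i)}) ->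
  {within K, continuous (fun p => existT Y (tag p) (f _ (tagged p)))}.
Proof.
move=> cf; apply/sigT_within_continuousP => i.
apply: (@within_continuous_comp _ _ _ _ _ (existT Y i) _ (cf i)) => y _.
exact: existT_continuous.
Qed.

Theorem theorem3p7 (R : realType) (I : choiceType) (X : I -> topologicalType)
    (hX : forall i : I, ps_tychonoff R (X i)) :
  ps_tychonoff R {i : I & X i}.
Proof.
have [Y hY] := choice hX; have {hX hY}hf i := cid (hY i).
pose f i := projT1 (hf i).
have tyY i : tychonoff_space (Y i) by have [] := projT2 (hf i).
have hg i : {g | cancel (f i) g /\ cancel g (f i)}.
  by apply: cid; have [_ [g fK gK] _] := projT2 (hf i); exists g.
pose g i := projT1 (hg i).
have fK i : cancel (f i) (g i) := (projT2 (hg i)).1.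
have gK i : cancel (g i) (f i) := (projT2 (hg i)).2.
have hK i (K : set (X i)) : pseudocompact R K ->
    {within K, continuous (f i)} /\ {within f i @` K, continuous (g i)}.
  move=> pK; apply/homeomorphism_restr_imageP => //.
  by have [_ _] := projT2 (hf i); exact.
pose F (p : {i & X i}) := existT Y (tag p) (f _ (tagged p)).
pose G (q : {i & Y i}) := existT X (tag q) (g _ (tagged q)).
have FK : cancel F G by case=> i x; rewrite /G/= fK.
have GK : cancel G F by case=> i x; rewrite /F/= gK.
exists {i & Y i}, F; split; last 2 first.
- by exists G.
- move=> K pK; apply/(homeomorphism_restr_imageP _ FK GK).
  split; apply: sigT_map_within_continuous => i.
    exact: (hK i _ (pseudocompact_existT_preimage pK)).1.
  (* [F] respects summands, so slicing commutes with taking images. If [F p] is [existT Y i y], then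
     applying [G] shows that [p] is [existT X i (g i y)], whence the witness [g i y]. *)
  have -> : existT Y i @^-1` (F @` K) = f i @` (existT X i @^-1` K).
    apply/seteqP; split=> [y [p Kp pE]|_ [x Kx <-]]; last first.
      by exists (existT X i x).
    by exists (g i y); rewrite ?gK//= -[existT _ _ _]/(G (existT Y i y)) -pE FK.
  exact: (hK i _ (pseudocompact_existT_preimage pK)).2.
split; first by apply: (completely_regular_sigT R) => i; exact: (tyY i).1.
by apply: accessible_sigT => i; exact: (tyY i).2.
Qed.
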